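(* Each of the following families of games is neither domestic nor returnable: Rook on the set of all nonempty partitions; Queen on the set of all nonempty partitions; King on the set of all nonempty subpartitions of generalized staircases.
   Context: A partition is a finite weakly decreasing sequence $\lambda=[\lambda_1,\ldots,\lambda_r]$ of positive integers; $[\,]$ is the empty partition, and $\mathbb Y^+$ is the set of nonempty partitions. For $i,j\ge 0$, $\lambda[i,j]=[\lambda_{i+1}-j,\lambda_{i+2}-j,\ldots]$ with trailing nonpositive entries removed. For a moveset $M\subseteq \mathbb Z_{\ge0}^2\setminus\{(0,0)\}$ and $\lambda\in\mathbb Y^+$, the impartial chess game $(M,\lambda)$ starts at $\lambda$, and from a position $\mu\in\mathbb Y^+$ a player may move to $\mu[i,j]$ for any $(i,j)\in M$ with $\mu[i,j]\ne[\,]$. The positions of $(M,\lambda)$ are the partitions reachable from $\lambda$ by zero or more moves. A position is terminal if it has no moves. Movesets: King $\{(0,1),(1,0),(1,1)\}$; Rook $\{(k,0):k\ge1\}\cup\{(0,k):k\ge1\}$; Queen $\{(k,0):k\ge1\}\cup\{(0,k):k\ge1\}\cup\{(k,k):k\ge1\}$. The generalized staircase with parameters $r,c,k\ge1$ is $[(kc)^r,((k-1)c)^r,\ldots,c^r]$ (exponents denote repetition). A nonempty subpartition of a generalized staircase $\lambda$ is a partition $\lambda[i,j]\neq[\,]$ with $i,j\ge0$. The Sprague-Grundy value of a position $p$ is $\mathrm{mex}$ of the Sprague-Grundy values of the positions reachable in one move ($0$ if $p$ is terminal), where $\mathrm{mex}(S)$ is the least nonnegative integer not in $S$. The misère Grundy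 value is defined by the same mex recursion at non-terminal positions, but terminal positions have value $1$. A position with Sprague-Grundy value $t$ and misère Grundy value $\ell$ is called a $(t,\ell)$-position. A game is returnable if for any move from a $(0,1)$-position (resp. a $(1,0)$-position) to a non-terminal position $y$, there is a move from $y$ to a $(0,1)$-position (resp. to a $(1,0)$-position). A game is domestic if it has neither $(0,k)$-positions nor $(k,0)$-positions with $k\ge2$. For a moveset $M$ and a set $P\subseteq\mathbb Y^+$, the family $(M,P)$ has one of these properties if $(M,\lambda)$ has it for every $\lambda\in P$, and it does not have the property if $(M,\lambda)$ fails it for at least one $\lambda\in P$ (the failing $\lambda$ may differ for different properties). *)

(* Defs.v *)
From mathcomp Require Import all_boot.
From Stdlib Require Import Relation_Operators.

Set Implicit Arguments.
Unset Strict Implicit.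
Unset Printing Implicit Defensive.

Definition is_partition (s : seq nat) : bool := sorted geq s && (0 \notin s).

Definition Yplus (s : seq nat) : Prop := is_partition s /\ s <> [::].

(* lambda[i,j]: truncated subtraction sends every nonpositive entry to 0, and
   on a weakly decreasing sequence the zeros are exactly the trailing ones. *)
Definition subpart (s : seq nat) (i j : nat) : seq nat :=
  [seq x <- [seq x - j | x <- drop i s] | 0 < x].

Record moveset := Moveset { steps :> rel nat; _ : ~~ steps 0 0 }.

Definition king : moveset := @Moveset
  (fun i j => (i, j) \in [:: (0, 1); (1, 0); (1, 1)]) isT.

Definition rook : moveset := @Moveset
  (fun i j => (1 <= i) && (j == 0) || (i == 0) && (1 <= j)) isT.

Definition queen : moveset := @Moveset
  (fun i j => [|| (1 <= i) && (j == 0), (i == 0) && (1 <= j)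
                | (1 <= i) && (j == i)]) isT.

Definition move (M : moveset) (mu nu : seq nat) : Prop :=
  exists i j, [/\ M i j, nu = subpart mu i j & nu <> [::]].

Definition terminal (M : moveset) (mu : seq nat) : Prop :=
  forall nu, ~ move M mu nu.

Definition position (M : moveset) (lam mu : seq nat) : Prop :=
  clos_refl_trans (seq nat) (move M) lam mu.

(* A move with i >= size mu or j >= max mu would lead to the empty partition,
   so this finite list enumerates all moves (optionsP). *)
Definition options (M : moveset) (mu : seq nat) : seq (seq nat) :=
  [seq nu <- [seq subpart mu i j | i <- iota 0 (size mu),
                                   j <- [seq j <- iota 0 (foldr maxn 0 mu) | M i j]]
         | ~~ nilp nu].

Lemma optionsP (M : moveset) (mu nu : seq nat) :
  reflect (move M mu nu) (nu \in options M mu).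
Proof.
rewrite mem_filter; apply: (iffP andP) => [[nu0 /allpairsPdep]|].
  move=> [i [j [_]]]; rewrite mem_filter => /andP[Mij _] def_nu.
  by exists i, j; split=> // nuE; rewrite nuE in nu0.
move=> [i [j [Mij -> /eqP nu0]]]; split; first by case: (subpart _ _ _) nu0.
have: has (fun x => 0 < x) [seq x - j | x <- drop i mu].
  by rewrite has_filter.
case/hasP=> _ /mapP[x x_mu ->] jx.
apply/allpairsPdep; exists i, j; split=> //; rewrite ?mem_filter ?Mij mem_iota /=.
  by rewrite add0n ltnNge; apply: contraL x_mu => /drop_oversize->.
rewrite add0n; apply: leq_trans (_ : x <= _); first by rewrite -subn_gt0.
have {x_mu nu0} := mem_drop x_mu; elim: mu => //= y s IHs.
by rewrite inE leq_max => /predU1P[->|/IHs->]; rewrite ?leqnn ?orbT.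
Qed.

Lemma terminalP (M : moveset) (mu : seq nat) :
  reflect (terminal M mu) (nilp (options M mu)).
Proof.
apply: (iffP nilP) => [opt0 nu /optionsP | term]; first by rewrite opt0.
case def_o: (options M mu) => [|nu o] //; case: (term nu).
by apply/optionsP; rewrite def_o mem_head.
Qed.

Definition mex (s : seq nat) : nat :=
  find (fun n => n \notin s) (iota 0 (size s).+1).

Lemma mexP (s : seq nat) : mex s \notin s /\ (forall m, m < mex s -> m \in s).
Proof.
have has_s: has (fun n => n \notin s) (iota 0 (size s).+1).
  apply/negPn/negP => /hasPn sub_s.
  have := @uniq_leq_size _ _ s (iota_uniq 0 (size s).+1).
  rewrite size_iota ltnn => /(_ _)/notF[] // x /sub_s.
  by rewrite negbK.
have lt_mex: mex s < (size s).+1 by rewrite -[X in _ < X](size_iota 0) -has_find.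
split=> [|m lt_m]; first by have:= nth_find 0 has_s; rewrite nth_iota.
have:= before_find 0 lt_m; rewrite nth_iota ?(ltn_trans lt_m) //.
by move/negbFE.
Qed.

(* t is the value of the terminal positions: 0 for normal play, 1 for misere
   play.  The fuel n is immaterial once n >= size mu + sumn mu, a quantity which
   decreases along every move; grundyE is the intended recursion. *)
Fixpoint grundy_rec (M : moveset) (t n : nat) (mu : seq nat) : nat :=
  if n isn't n'.+1 then t else
  let o := options M mu in
  if nilp o then t else mex [seq grundy_rec M t n' nu | nu <- o].

Definition grundy (M : moveset) (t : nat) (mu : seq nat) : nat :=
  grundy_rec M t (size mu + sumn mu) mu.

Lemma move_decr (M : moveset) (mu nu : seq nat) :
  move M mu nu -> size nu + sumn nu < size mu + sumn mu.
Proof.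
have le_sub (s : seq nat) j :
    size (subpart s 0 j) <= size s /\ sumn (subpart s 0 j) <= sumn s.
  rewrite /subpart drop0; elim: s => //= x s [IH1 IH2].
  case: ifP => _ /=; split=> //; first exact: leq_add (leq_subr _ _) IH2.
    exact: leqW.
  exact: leq_trans IH2 (leq_addl _ _).
have sub_drop (s : seq nat) i j : subpart s i j = subpart (drop i s) 0 j.
  by rewrite /subpart drop0.
case: M => M M00 [[|i] [j [/= Mij -> sub0]]]; last first.
  rewrite sub_drop; have [le1 le2] := le_sub (drop i.+1 mu) j.
  case: mu sub0 le1 le2 {Mij} => [|x mu _] //= le1 le2.
  rewrite addSn ltnS leq_add //.
    by apply: leq_trans le1 _; rewrite size_drop leq_subr.
  apply: leq_trans le2 (leq_trans _ (leq_addl _ _)).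
  by rewrite -[X in _ <= sumn X](cat_take_drop i) sumn_cat leq_addl.
case: j Mij sub0 => [Mij|j _]; first by rewrite Mij in M00.
elim: mu => [|x mu IHmu] // sub0.
have [le1 le2] := le_sub mu j.+1.
rewrite /subpart drop0 in le1 le2 IHmu sub0 *; rewrite /= in sub0 *.
case: ifP sub0 => [jx _ | _ sub0] /=.
  have lt_x: x - j.+1 < x by rewrite ltn_subrL; apply: leq_trans jx (leq_subr _ _).
  by rewrite -addnS leq_add // -addSn leq_add.
by apply: leq_trans (IHmu sub0) _; rewrite addSn leqW // leq_add2l leq_addl.
Qed.

Lemma grundyE (M : moveset) (t : nat) (mu : seq nat) :
  grundy M t mu =
  if nilp (options M mu) then t else mex [seq grundy M t nu | nu <- options M mu].
Proof.
have stable n : forall s, size s + sumn s <= n -> grundy_rec M t n s = grundy M t s.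
  elim/ltn_ind: n => n IHn s; rewrite leq_eqVlt => /predU1P[<- // | lt_s_n].
  case: n => // n in IHn lt_s_n *; rewrite /grundy.
  case def_m: (size s + sumn s) => [|m] /=.
    case: ifPn => //; case def_o: (options M s) => [|nu o] // _.
    have/optionsP/move_decr: nu \in options M s by rewrite def_o mem_head.
    by rewrite def_m.
  case: ifP => // _; congr mex; apply/eq_in_map => nu /optionsP/move_decr.
  rewrite def_m ltnS => le_nu_m.
  have lt_m_n: m < n by rewrite def_m ltnS in lt_s_n.
  rewrite (IHn n) // ?(leq_trans le_nu_m (ltnW lt_m_n)) // (IHn m) //.
  exact: ltn_trans lt_m_n _.
rewrite {1}/grundy; case def_m: (size mu + sumn mu) => [|m] /=.
  case def_o: (options M mu) => [|nu o] //.
  have/optionsP/move_decr: nu \in options M mu by rewrite def_o mem_head.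
  by rewrite def_m.
case: ifP => // _; congr mex; apply/eq_in_map => nu /optionsP/move_decr.
by rewrite def_m ltnS => /stable.
Qed.

Definition sprague_grundy (M : moveset) : seq nat -> nat := grundy M 0.
Definition misere_grundy (M : moveset) : seq nat -> nat := grundy M 1.

(* the (t,l)-positions *)
Definition tl_position (M : moveset) (t l : nat) (mu : seq nat) : Prop :=
  sprague_grundy M mu = t /\ misere_grundy M mu = l.

Definition returnable_for (M : moveset) (lam : seq nat) (t l : nat) : Prop :=
  forall x y, position M lam x -> tl_position M t l x -> move M x y ->
    ~ terminal M y -> exists2 z, move M y z & tl_position M t l z.

Definition returnable (M : moveset) (lam : seq nat) : Prop :=
  returnable_for M lam 0 1 /\ returnable_for M lam 1 0.

Definition domestic (M : moveset) (lam : seq nat) : Prop :=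
  forall mu k, position M lam mu -> 2 <= k ->
    ~ tl_position M 0 k mu /\ ~ tl_position M k 0 mu.

Definition family_fails (Q : moveset -> seq nat -> Prop) (M : moveset)
    (P : seq nat -> Prop) : Prop :=
  exists2 lam, P lam & ~ Q M lam.

Definition staircase (r c k : nat) : seq nat :=
  flatten [seq nseq r (m * c) | m <- rev (iota 1 k)].

Definition staircase_subpart (s : seq nat) : Prop :=
  exists r c k i j : nat,
    [/\ 1 <= r, 1 <= c, 1 <= k, s = subpart (staircase r c k) i j & s <> [::]].

Lemma subpart_is_partition (s : seq nat) (i j : nat) :
  is_partition s -> is_partition (subpart s i j).
Proof.
case/andP=> s_sorted _; apply/andP; split; last by rewrite mem_filter.
have geq_tr : transitive geq by move=> y x z /= yx zy; exact: leq_trans zy yx.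
apply: sorted_filter => //; apply: homo_sorted (drop_sorted _ s_sorted).
by move=> x y /= yx; rewrite leq_sub2r.
Qed.

Lemma staircase_is_partition (r c k : nat) :
  1 <= c -> is_partition (staircase r c k).
Proof.
move=> c_gt0; rewrite /staircase /is_partition.
have in_stair l x : x \in flatten [seq nseq r (m * c) | m <- l] ->
    exists2 m, m \in l & x = m * c.
  case/flatten_mapP=> m l_m; rewrite mem_nseq => /andP[_ /eqP->].
  by exists m.
have geq_tr : transitive geq by move=> y x z /= yx zy; exact: leq_trans zy yx.
apply/andP; split; last first.
  apply/negP=> /in_stair[m]; rewrite mem_rev mem_iota => /andP[m_gt0 _] /eqP.
  by rewrite eq_sym muln_eq0 !eqn0Ngt m_gt0 c_gt0.
rewrite sorted_pairwise //.
have: pairwise geq (rev (iota 1 k)).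
  rewrite -sorted_pairwise // rev_sorted.
  by apply: sub_sorted (iota_ltn_sorted 1 k) => m n /ltnW.
elim: (rev _) => //= m l IHl /andP[/allP m_l /IHl l_sorted].
rewrite pairwise_cat l_sorted andbT; apply/andP; split.
  apply/allrelP => x y; rewrite mem_nseq => /andP[_ /eqP->] /in_stair[n l_n ->].
  by rewrite /= leq_mul2r [n <= m]m_l ?orbT.
rewrite -sorted_pairwise //; elim: (r) => [|[|n] IHn] //=.
by rewrite leqnn.
Qed.

Lemma staircase_subpart_Yplus (s : seq nat) : staircase_subpart s -> Yplus s.
Proof.
case=> r [c [k [i [j [_ c1 _ -> s0]]]]]; split=> //.
exact/subpart_is_partition/staircase_is_partition.
Qed.

(* Main.v *)
Require Import Defs.
From mathcomp Require Import all_boot.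
From Stdlib Require Import Relation_Operators.

(** One partition refutes each property, and a finite computation checks it: the
    positions of [(M, lam)] are nonempty partitions [subpart lam i j] with
    [i < size lam] and [j < lam_1], so the values of all of them can be
    tabulated, although the number of plays is exponential. *)

(* A position missing from the table falls back on [grundy]: this makes the
   lookup correct for every sound table, without a completeness condition. *)
Fixpoint lookup (M : moveset) (t : nat) (T : seq (seq nat * nat))
    (mu : seq nat) : nat :=
  if T is (nu, v) :: T' then if nu == mu then v else lookup M t T' mu
  else grundy M t mu.

(* [foldr] fills the table from the right, so listing a position before its
   options lets their values be looked up rather than recomputed. *)
Definition grundy_table (M : moveset) (t : nat) (s : seq (seq nat)) :
    seq (seq nat * nat) :=
  foldr (fun mu T => let o := options M mu in
           (mu, if nilp o then t else mex [seq lookup M t T nu | nu <- o]) :: T)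
        [::] s.

Lemma lookup_table M t s mu : lookup M t (grundy_table M t s) mu = grundy M t mu.
Proof.
elim: s mu => //= nu s IHs mu.
case: eqP => // <-; rewrite [RHS]grundyE; case: ifP => // _.
by congr mex; apply: eq_map.
Qed.

(** A move raises [i] or [j], so lexicographic order puts positions before their options. The tables
    are bound outside the [fun], to be built only once. *)
Definition values (M : moveset) (lam : seq nat) : seq nat -> nat * nat :=
  let ps := [seq subpart lam i j | i <- iota 0 (size lam),
                                   j <- iota 0 (head 0 lam)] in
  let T0 := grundy_table M 0 ps in
  let T1 := grundy_table M 1 ps in
  fun mu => (lookup M 0 T0 mu, lookup M 1 T1 mu).

Lemma valuesE M lam mu :
  values M lam mu = (sprague_grundy M mu, misere_grundy M mu).
Proof. by rewrite /values !lookup_table. Qed.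

Lemma tl_positionP M lam t l mu :
  reflect (tl_position M t l mu) (values M lam mu == (t, l)).
Proof.
by rewrite valuesE xpair_eqE; apply: (iffP andP) => [] [/eqP ? /eqP].
Qed.

Lemma not_domestic M lam k :
  2 <= k -> values M lam lam \in [:: (0, k); (k, 0)] -> ~ domestic M lam.
Proof.
move=> k_ge2; rewrite !inE => val_lam /(_ lam k (rt_refl _ _ _) k_ge2) [not0k notk0].
by case/orP: val_lam => /tl_positionP.
Qed.

(** The bad move starts at [lam], so the value to return to is [v lam], for both types at once. *)
Lemma not_returnable M lam y :
  let v := values M lam in
  [&& v lam \in [:: (0, 1); (1, 0)], y \in options M lam,
      ~~ nilp (options M y) & v lam \notin map v (options M y)] ->
  ~ returnable M lam.
Proof.
move=> v /and4P[val_lam /optionsP lam_y y_nonterm no_z] [ret01 ret10].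
have not_term : ~ terminal M y by move/terminalP; apply/negP.
have returning t l : v lam = (t, l) -> returnable_for M lam t l -> False.
  move=> v_lam ret; case/negP: no_z; apply/mapP.
  have [z y_z /tl_positionP z_tl] : exists2 z, move M y z & tl_position M t l z.
    apply: ret lam_y not_term; first exact: rt_refl.
    by apply/(tl_positionP M lam)/eqP.
  by exists z; [apply/optionsP | rewrite v_lam; apply/esym/eqP/z_tl].
by move: val_lam; rewrite !inE => /orP[] /eqP /returning; apply.
Qed.

Lemma YplusP s : reflect (Yplus s) (is_partition s && ~~ nilp s).
Proof. by apply: (iffP andP) => -[? /nilP]. Qed.

Theorem theorem4p15 :
  [/\ family_fails domestic rook Yplus /\ family_fails returnable rook Yplus,
      family_fails domestic queen Yplus /\ family_fails returnable queen Yplus &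
      family_fails domestic king staircase_subpart /\
      family_fails returnable king staircase_subpart].
Proof.
split; split.
(* A rectangle plus one cell: Rook on rectangles is two-heap Nim, but here the value is [(4, 0)]. *)
- exists [:: 5; 4; 4; 4]; first exact/YplusP.
  by apply: (@not_domestic _ _ 4) => //; vm_compute.
- exists [:: 6; 5; 5; 5; 5]; first exact/YplusP.
  by apply: (@not_returnable _ _ [:: 4; 3; 3; 3; 3]); vm_compute.
- exists [:: 9; 8; 8; 8; 8]; first exact/YplusP.
  by apply: (@not_domestic _ _ 10) => //; vm_compute.
(* Removing two columns leaves a rectangle, where Queen is Wythoff's game. *)
- exists [:: 9; 9; 9; 9; 9; 2]; first exact/YplusP.
  by apply: (@not_returnable _ _ [:: 7; 7; 7; 7; 7]); vm_compute.
(* A staircase without its first row and column; its value is [(0, 2)]. *)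
- exists [:: 7; 5; 5; 3; 3; 1; 1]; first by exists 2, 2, 4, 1, 1.
  by apply: (@not_domestic _ _ 2) => //; vm_compute.
- exists [:: 9; 7; 7; 5; 5; 3; 3; 1; 1]; first by exists 2, 2, 5, 1, 1.
  (* The start is a [(0, 1)]-position; the options of [y] have values [(2, 1)] and [(0, 0)]. *)
  by apply: (@not_returnable _ _ [:: 6; 6; 4; 4; 2; 2]); vm_compute.
Qed.
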